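(* Let $X=X(Q_0)$ be a rearrangement invariant space. If the lower Boyd index $\alpha_X$ of $X$ is positive, then $X^{\#}\subset X$.
   Context: $Q_0\subset\mathbb R^n$ is a fixed cube with $|Q_0|=1$; all cubes have sides parallel to the coordinate axes. $f_Q=\frac1{|Q|}\int_Qf$. Rearrangement invariant (r.i.) space $X$ on $Q_0$: a Banach function space on $(Q_0,dx)$ which is either separable or has the Fatou property ($0\le f_n\uparrow f\in X$ implies $\|f_n\|_X\uparrow\|f\|_X$), such that $g\in X$ and $f^*=g^*$ imply $f\in X$ and $\|f\|_X=\|g\|_X$, where $f^*$ denotes the decreasing rearrangement of $|f|$. One has $L^\infty\subset X\subset L^1$ with continuous embeddings. The representation space $\bar X$ is the unique r.i. space on $(0,1)$ with $\|f\|_X=\|f^*\|_{\bar X}$. For $s>0$ the dilation operator on $\bar X$ is $\sigma_sf(t)=f^*(t/s)$ if $0<t<s$ and $\sigma_sf(t)=0$ if $t\ge s$ ($t\in(0,1)$). The lower Boyd index is $\alpha_X=\lim_{s\to0+}\frac{\ln\|\sigma_s\|_{\bar X\to\bar X}}{\ln s}$. For $f\in L^1(Q_0)$ the sharp maximal function is $f^{\#}_{Q_0}(x)=\sup_{Q\ni x,\ Q\subset Q_0}\frac1{|Q|}\int_Q|f(y)-f_Q|\,dy$, $x\in Q_0$ (supremum over cubes), and $X^{\#}=\{f\in L^1(Q_0): f^{\#}_{Q_0}\in X\}$ with $\|f\|_{X^{\#}}=\|f^{\#}_{Q_0}\|_X$. *)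

(* Defs.v *)
From HB Require Import structures.
From mathcomp Require Import all_boot all_order all_algebra.
From mathcomp Require Import all_classical all_reals all_analysis.

Set Implicit Arguments.
Unset Strict Implicit.
Unset Printing Implicit Defensive.

Import Order.TTheory GRing.Theory Num.Theory.
Import numFieldNormedType.Exports.

Local Open Scope classical_set_scope.
Local Open Scope ring_scope.

Notation Rn R n := (n.-tuple (measurableTypeR R)).

Section lebesgue_Rn.
Context {R : realType}.

Definition consRn n (p : measurableTypeR R * Rn R n) : Rn R n.+1 :=
  [tuple of p.1 :: p.2].

Lemma measurable_consRn n : measurable_fun [set: _] (@consRn n).
Proof. exact: measurable_cons. Qed.

Section step.
Variables (n : nat) (mu : {sigma_finite_measure set (Rn R n) -> \bar R}).

Definition lebesgue_step : set (Rn R n.+1) -> \bar R :=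
  pushforward (@lebesgue_measure R \x mu)%E (@consRn n).

HB.instance Definition _ := Measure.copy lebesgue_step
  (measure_function_pushforward__canonical__measure_function_Measure
     (@lebesgue_measure R \x mu)%E (@measurable_consRn n)).

Let lebesgue_step_sigma_finite : sigma_finite setT lebesgue_step.
Proof.
have /sigma_finiteP[F [TF ndF Foo]] := sigma_finiteT (@lebesgue_measure R).
have /sigma_finiteP[G [TG ndG Goo]] := sigma_finiteT mu.
pose g (x : Rn R n.+1) : measurableTypeR R * Rn R n :=
  (thead x, [tuple of behead x]).
have gK : cancel g (@consRn n) by move=> x; rewrite /consRn/= -tuple_eta.
have consK : cancel (@consRn n) g.
  move=> [a x]; rewrite /g /consRn/= theadE; congr pair.
  exact: val_inj.
have mg : measurable_fun [set: _] g.
  apply: measurable_fun_pair; last exact: measurable_behead.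
  exact: measurable_tnth.
exists (fun k => g @^-1` (F k `*` G k)).
  apply/esym; rewrite -subTset => x _.
  have [k _ Fk] : (\bigcup_k F k) (thead x) by rewrite -TF.
  have [l _ Gl] : (\bigcup_k G k) [tuple of behead x] by rewrite -TG.
  exists (maxn k l) => //; split.
  - by move: Fk => /=; apply/subsetPset/ndF/leq_maxl.
  - by move: Gl => /=; apply/subsetPset/ndG/leq_maxr.
move=> k; have [mFk Fk] := Foo k; have [mGk Gk] := Goo k; split.
  by rewrite -[X in measurable X]setTI; apply: mg => //; exact: measurableX.
rewrite /lebesgue_step /pushforward -comp_preimage.
rewrite (_ : g \o _ = id) ?preimage_id; last exact/funext.
by rewrite product_measure1E// lte_mul_pinfty// ge0_fin_numE.
Qed.

HB.instance Definition _ := Measure_isSigmaFinite.Build _ _ _ lebesgue_step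
  lebesgue_step_sigma_finite.

End step.

(* Lebesgue measure on the Borel sets of [R^n]: a point mass on [R^0], and
   [lebesgue_measure \x lebesgue_Rn n] carried to [R^(n+1)] by [cons]. *)
Fixpoint lebesgue_Rn n : {sigma_finite_measure set (Rn R n) -> \bar R} :=
  match n with
  | 0 => \d_([tuple] : Rn R 0)
  | n.+1 => lebesgue_step (lebesgue_Rn n)
  end.

Lemma lebesgue_Rn_box n (a b : 'I_n -> R) : (forall i, a i <= b i) ->
  lebesgue_Rn n [set x | forall i, a i <= tnth x i <= b i]
  = (\prod_(i < n) (b i - a i))%:E.
Proof.
elim: n a b => [|n IH] a b ab.
  by rewrite big_ord0 /= diracE mem_set// => -[].
have mbox m (c d : 'I_m -> R) :
    measurable [set x : Rn R m | forall i, c i <= tnth x i <= d i].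
  rewrite (_ : [set _ | _] = \bigcap_(i in [set: 'I_m])
      ((fun x : Rn R m => tnth x i) @^-1` `[c i, d i])); last first.
    apply/seteqP; split=> x /= H i; first by move=> _; rewrite /= in_itv/= H.
    by have := H i I; rewrite /= in_itv.
  apply: fin_bigcap_measurable => // i _; rewrite -[X in measurable X]setTI.
  exact: measurable_tnth.
rewrite /= /lebesgue_step /pushforward.
set A := _ @^-1` _.
have -> : A = `[a ord0, b ord0]%classic `*`
    [set x : Rn R n | forall i, a (lift ord0 i) <= tnth x i <= b (lift ord0 i)].
  apply/seteqP; split=> -[u x] /=.
    move=> H; split => [|i]; first by have := H ord0; rewrite in_itv.
    by have := H (lift ord0 i); rewrite tnthS.
  rewrite in_itv/= => -[H0 H] i.
  by case: (unliftP ord0 i) => [j|] ->; rewrite ?tnthS.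
rewrite product_measure1E//; last exact: mbox.
rewrite IH//= lebesgue_measure_itv/= big_ord_recl EFinM; congr (_ * _)%E.
rewrite lte_fin; case: ltP => // ba.
by rewrite (@le_anti _ _ (a ord0) (b ord0)) ?subrr// ab ba.
Qed.

End lebesgue_Rn.
Arguments lebesgue_Rn : clear implicits.

Section rearrangement.
Context d (T : measurableType d) (R : realType).
Variables (mu : {measure set T -> \bar R}) (D : set T).

(* The decreasing rearrangement of [|f|] for [f] living on [D]. It is only
   meant for [0 < t]: there the set below is nonempty as soon as [D] has finite
   measure, so that [inf] is the actual infimum. *)
Definition rearrangement (f : T -> R) (t : R) : R :=
  inf [set l : R | 0 <= l /\
                   (mu (D `&` [set x | (l < `|f x|)%R]) <= t%:E)%E].

End rearrangement.

(* A space of functions defined on a subset [D] of [T], given by its elements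
   and its norm; functions are total, and the axioms below make membership and
   norm depend only on the a.e. class of the restriction to [D]. *)
Record function_space (T : Type) (R : realType) := FunctionSpace {
  carrier : set (T -> R) ;
  fnorm : (T -> R) -> R }.

Section ri_space.
Context d (T : measurableType d) (R : realType).
Variables (mu : {measure set T -> \bar R}) (D : set T).
Variable X : function_space T R.

Record is_banach_function_space : Prop := {
  bfs_measurable : forall f, carrier X f -> measurable_fun D f ;
  bfs_add : forall f g, carrier X f -> carrier X g -> carrier X (f \+ g) ;
  bfs_scale : forall (a : R) f, carrier X f -> carrier X (fun x => a * f x) ;
  bfs_normD : forall f g, carrier X f -> carrier X g ->
    fnorm X (f \+ g) <= fnorm X f + fnorm X g ;
  bfs_normZ : forall (a : R) f, carrier X f ->
    fnorm X (fun x => a * f x) = `|a| * fnorm X f ;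
  bfs_norm0 : forall f, carrier X f -> fnorm X f = 0 ->
    {ae mu, forall x, D x -> f x = 0} ;
  bfs_ideal : forall f g : T -> R, measurable_fun D f -> carrier X g ->
    {ae mu, forall x, D x -> `|f x| <= `|g x|} ->
    carrier X f /\ fnorm X f <= fnorm X g ;
  bfs_complete : forall u : nat -> T -> R, (forall k, carrier X (u k)) ->
    (forall e : R, 0 < e -> exists K : nat, forall i j : nat,
      (K <= i)%N -> (K <= j)%N -> fnorm X (u i \- u j) < e) ->
    exists2 f, carrier X f & fnorm X (u k \- f) @[k --> \oo] --> 0 ;
  bfs_Linfty_sub : exists C : R, forall (f : T -> R) (M : R),
    measurable_fun D f -> {ae mu, forall x, D x -> `|f x| <= M} ->
    carrier X f /\ fnorm X f <= C * M ;
  bfs_sub_L1 : exists C : R, forall f, carrier X f ->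
    mu.-integrable D (EFin \o f) /\ \int[mu]_(x in D) `|f x| <= C * fnorm X f }.

Definition separable_space : Prop :=
  exists u : nat -> T -> R, (forall k, carrier X (u k)) /\
    forall f, carrier X f -> forall e : R, 0 < e ->
      exists k, fnorm X (f \- u k) < e.

(* The norms [fnorm X (u k)] are automatically nondecreasing, by [bfs_ideal]. *)
Definition fatou_property : Prop :=
  forall (u : nat -> T -> R) (f : T -> R),
    (forall k, measurable_fun D (u k)) -> carrier X f ->
    {ae mu, forall x, D x -> [/\ forall k, 0 <= u k x,
      nondecreasing_seq (u ^~ x) & u k x @[k --> \oo] --> f x]} ->
    fnorm X (u k) @[k --> \oo] --> fnorm X f.

Definition is_ri_space : Prop :=
  [/\ is_banach_function_space,
      separable_space \/ fatou_property &
      forall f g : T -> R, measurable_fun D f -> carrier X g ->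
        (forall t : R, 0 < t -> rearrangement mu D f t = rearrangement mu D g t) ->
        carrier X f /\ fnorm X f = fnorm X g].

End ri_space.

Definition unit_itv (R : realType) : set (measurableTypeR R) :=
  `](0 : R), 1[%classic.

Definition is_representation_space d (T : measurableType d) (R : realType)
    (mu : {measure set T -> \bar R}) (D : set T) (X : function_space T R)
    (Xbar : function_space (measurableTypeR R) R) : Prop :=
  is_ri_space (@lebesgue_measure R) (@unit_itv R) Xbar /\
  forall f : T -> R, measurable_fun D f ->
    (carrier X f <-> carrier Xbar (rearrangement mu D f)) /\
    (carrier X f -> fnorm X f = fnorm Xbar (rearrangement mu D f)).

Section boyd_index.
Context (R : realType).

Definition dilation (s : R) (f : measurableTypeR R -> R)
    (t : measurableTypeR R) : R :=
  if 0 < (t : R) < s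
  then rearrangement (@lebesgue_measure R) (@unit_itv R) f ((t : R) / s) else 0.

Definition dilation_norm (Xbar : function_space (measurableTypeR R) R) (s : R)
    : R :=
  sup [set fnorm Xbar (dilation s f) | f in
        [set f | carrier Xbar f /\ fnorm Xbar f <= 1]].

Definition lower_boyd_index (Xbar : function_space (measurableTypeR R) R) : R :=
  lim ((ln (dilation_norm Xbar s) / ln s) @[s --> 0^'+]).

End boyd_index.

Section sharp.
Context (R : realType) (n : nat).
Implicit Types (Q : set (Rn R n)) (f : Rn R n -> R).

Definition is_cube Q : Prop :=
  exists (a : 'I_n -> R) (l : R), 0 < l /\
    Q = [set x | forall i, a i <= tnth x i <= a i + l].

Definition mean Q f : R :=
  (fine (lebesgue_Rn R n Q))^-1 * \int[lebesgue_Rn R n]_(x in Q) f x.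

Definition sharp_maximal (Q0 : set (Rn R n)) f (x : Rn R n) : \bar R :=
  ereal_sup [set (mean Q (fun y => `|f y - mean Q f|))%:E | Q in
              [set Q | [/\ is_cube Q, Q x & Q `<=` Q0]]].

(* [sharp_maximal Q0 f] may take the value [+oo]; it is in [X] when it agrees
   a.e. on [Q0] with a real-valued element of [X]. *)
Definition sharp_space (Q0 : set (Rn R n)) (X : function_space (Rn R n) R)
    : set (Rn R n -> R) :=
  [set f | (lebesgue_Rn R n).-integrable Q0 (EFin \o f) /\
    exists2 h, carrier X h &
      {ae lebesgue_Rn R n, forall x, Q0 x -> sharp_maximal Q0 f x = (h x)%:E}].

End sharp.

(* Main.v *)
Require Import Defs.
From mathcomp Require Import all_boot all_order all_algebra.
From mathcomp Require Import lra.
From mathcomp Require Import all_classical all_reals all_analysis.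
From mathcomp Require Import measurable_realfun.

Set Implicit Arguments.
Unset Strict Implicit.
Unset Printing Implicit Defensive.

Import Order.TTheory GRing.Theory Num.Theory.
Import numFieldNormedType.Exports.

Local Open Scope classical_set_scope.
Local Open Scope ring_scope.

(** Write [f*] for the decreasing rearrangement of [f] and [h] for the sharp
    maximal function of [f]. For [0 < t <= 1/8] one has
      [f*(t) <= f*(2t) + C h*(2t)].
    Indeed let [G] be the set where [|f| > f*(2t)] or [h > h*(2t)], and cover
    almost all of it by the maximal dyadic cubes of which [G] fills more than
    half. The parent [P] of such a cube is at least half outside [G]: there
    [|f| <= f*(2t)], and some point of it has [h <= h*(2t)], which bounds the
    mean oscillation of [f] on [P]. Chebyshev's inequality on each [P] then
    bounds the measure of the set where [|f| > f*(2t) + C h*(2t)].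

    Iterating, [f*] is at most a constant plus [C] times the sum over [k] of
    [h*(2^(k+1) t)], whose terms are dominated by the dilations of [h*] by
    [2^-k]. If the lower Boyd index is positive these have geometrically
    decreasing norms, so that the series converges in the representation space
    and its sum dominates [f*]. *)

(** * Dyadic cells *)

(** Countable additivity on both sides. The pieces are later either the cells of one level or the
    sets of points stopped at a given level. *)
Lemma measure_le_partition d (T : measurableType d) (R : realType)
    (mu : {measure set T -> \bar R}) (F : (set T)^nat) (S U : set T) (c : R) :
  (forall j, measurable (F j)) -> trivIset setT F ->
  measurable S -> measurable U ->
  (forall j, mu (S `&` F j) <= c%:E * mu (U `&` F j))%E ->
  (mu (S `&` \bigcup_j F j) <= c%:E * mu (U `&` \bigcup_j F j))%E.
Proof.
move=> mF tF mS mU SU; rewrite !setI_bigcupr !measure_bigcup//.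
- rewrite -nneseriesZl//; exact: lee_nneseries.
- by move=> j _; exact: measurableI.
- exact: trivIset_setIl.
- by move=> j _; exact: measurableI.
- exact: trivIset_setIl.
Qed.

Section dyadic.
Context {R : realType} (n : nat) (a : 'I_n -> R) (l : R).
Hypothesis l0 : 0 < l.
Local Notation mu := (lebesgue_Rn R n).
Implicit Types (x y : Rn R n) (S U : set (Rn R n)) (N : nat).

(** The grid is anchored at [a] with mesh [l / 2 ^+ N] and fills all of the space. Floors make the
    cells half-open, so those of one level partition it, and nesting becomes arithmetic on
    integers. *)
Definition coordinate N (u : R) i : int :=
  Num.floor (2 ^+ N * ((u - a i) / l)).

Definition cell_code N x : {ffun 'I_n -> int} :=
  [ffun i => coordinate N (tnth x i) i].

Definition cell N x : set (Rn R n) := [set y | cell_code N y = cell_code N x].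

Definition corner N x (i : 'I_n) : R :=
  a i + (l / 2 ^+ N) * (cell_code N x i)%:~R.

(** [is_cube] asks for closed boxes, so these are the cubes seen by the sharp maximal function. They
    exceed the half-open cells by null sets only. *)
Definition closed_cell N x : set (Rn R n) :=
  [set y | forall i, corner N x i <= tnth y i <= corner N x i + l / 2 ^+ N].

Definition saturated N U :=
  forall x y, cell_code N x = cell_code N y -> U x -> U y.

Lemma cellP N x y : cell N x y <->
  forall i, corner N x i <= tnth y i < corner N x i + l / 2 ^+ N.
Proof.
have H i : (cell_code N y i == cell_code N x i) =
    (corner N x i <= tnth y i < corner N x i + l / 2 ^+ N).
  rewrite [cell_code N y i]ffunE /coordinate floor_eq /corner intrD.
  have p2 : 0 < 2 ^+ N :> R by rewrite exprn_gt0.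
  set k : R := _%:~R; set u := tnth y i.
  have -> : 2 ^+ N * ((u - a i) / l) = (u - a i) / (l / 2 ^+ N).
    by rewrite invf_div mulrCA.
  have w0 : 0 < l / 2 ^+ N by rewrite divr_gt0.
  rewrite ler_pdivlMr// ltr_pdivrMr//; congr (_ && _); apply/idP/idP => ?; lra.
split=> [e i|h]; first by rewrite -H (e : cell_code N y = _).
by apply/ffunP => i; apply/eqP; rewrite H.
Qed.

(** One level at a time: for an integer [p], [p <= 2 ^+ K * z] is equivalent to
    [2 * p <= 2 ^+ K.+1 * z], so the finer floor determines the coarser one. *)
Lemma cell_code_coarser N M x y : (N <= M)%N -> cell_code M x = cell_code M y ->
  cell_code N x = cell_code N y.
Proof.
move=> NM; have -> : M = (M - N + N)%N by rewrite subnK.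
elim: (M - N)%N => // k IH e; apply: IH.
move: e; rewrite addSn; move: (k + N)%N => {NM M k} K /ffunP e.
have half u v i : coordinate K.+1 u i = coordinate K.+1 v i ->
    coordinate K u i <= coordinate K v i.
  move=> h; rewrite /coordinate floor_ge_int.
  set p := Num.floor _.
  have : 2 * p <= coordinate K.+1 u i.
    rewrite /coordinate floor_ge_int intrM exprS -mulrA ler_pM2l//.
    exact: floor_le.
  by rewrite h /coordinate floor_ge_int intrM exprS -mulrA ler_pM2l.
apply/ffunP => i; have := e i; rewrite !ffunE => h.
by apply/eqP; rewrite eq_le !half.
Qed.

Lemma saturatedW N M U : (N <= M)%N -> saturated N U -> saturated M U.
Proof. by move=> NM sU x y /(cell_code_coarser NM); exact: sU. Qed.

Lemma saturated_cell N x : saturated N (cell N x).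
Proof. by move=> u v; rewrite /cell/= => ->. Qed.

Lemma saturatedC N U : saturated N U -> saturated N (~` U).
Proof. by move=> sU x y e nU Uy; apply: nU; apply: sU Uy. Qed.

Lemma saturatedU N U S : saturated N U -> saturated N S -> saturated N (U `|` S).
Proof. by move=> sU sS x y e [/(sU _ _ e)|/(sS _ _ e)]; [left|right]. Qed.

Lemma measurable_box (c d : 'I_n -> R) :
  measurable [set x : Rn R n | forall i, c i <= tnth x i <= d i].
Proof.
rewrite (_ : [set _ | _] = \bigcap_(i in [set: 'I_n])
    ((fun x : Rn R n => tnth x i) @^-1` `[c i, d i])); last first.
  apply/seteqP; split=> x /= H i; first by move=> _; rewrite /= in_itv/= H.
  by have := H i I; rewrite /= in_itv.
apply: fin_bigcap_measurable => // i _; rewrite -[X in measurable X]setTI.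
exact: measurable_tnth.
Qed.

Lemma measurable_closed_cell N x : measurable (closed_cell N x).
Proof. exact: measurable_box. Qed.

Lemma measurable_cell N x : measurable (cell N x).
Proof.
rewrite (_ : cell N x = \bigcap_(i in [set: 'I_n]) ((fun y : Rn R n => tnth y i)
   @^-1` `[corner N x i, corner N x i + l / 2 ^+ N[)); last first.
  apply/seteqP; split=> y; first by move=> /cellP h i _/=; rewrite in_itv/=.
  by move=> h; apply/cellP => i; have := h i I; rewrite /= in_itv.
apply: fin_bigcap_measurable => // i _; rewrite -[X in measurable X]setTI.
exact: measurable_tnth.
Qed.

(* Cells of level [N] are numbered by [pickle], so that no count is needed. *)
Definition numbered_cell N j : set (Rn R n) :=
  [set x | pickle (cell_code N x) = j].

Lemma numbered_cellE N x : numbered_cell N (pickle (cell_code N x)) = cell N x.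
Proof.
apply/seteqP; split=> y /=; last by rewrite /cell /numbered_cell/= => ->.
by move=> /(pcan_inj pickleK).
Qed.

Lemma numbered_cellVset0 N j :
  numbered_cell N j = set0 \/ exists2 x, numbered_cell N j x &
  numbered_cell N j = cell N x.
Proof.
have [->|/set0P[x jx]] := eqVneq (numbered_cell N j) set0; [by left|right].
by exists x => //; rewrite -numbered_cellE jx.
Qed.

Lemma bigcup_numbered_cell N U : \bigcup_j (numbered_cell N j `&` U) = U.
Proof.
rewrite -setI_bigcupl; apply/seteqP; split=> [x []//|x Ux]; split=> //.
by exists (pickle (cell_code N x)).
Qed.

Lemma measurable_saturated N U : saturated N U -> measurable U.
Proof.
move=> sU; rewrite -(bigcup_numbered_cell N U).
apply: bigcup_measurable => j _.
have [->|[x jx ->]] := numbered_cellVset0 N j; first by rewrite set0I.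
have [Ux|nUx] := pselect (U x).
  rewrite setIidl; first exact: measurable_cell.
  by move=> y /esym e; exact: sU e Ux.
rewrite (_ : _ `&` _ = set0)//; apply/seteqP; split=> // y [e Uy].
by apply: nUx; exact: sU e Uy.
Qed.

(** [U] is a disjoint union of numbered cells, and numbers that belong to no cell in [U] contribute
    empty pieces. *)
Lemma saturated_le N U S G (c : R) : saturated N U ->
  measurable S -> measurable G ->
  (forall x, U x -> mu (S `&` cell N x) <= c%:E * mu (G `&` cell N x))%E ->
  (mu (S `&` U) <= c%:E * mu (G `&` U))%E.
Proof.
move=> sU mS mG h.
rewrite -(bigcup_numbered_cell N U); apply: measure_le_partition => //.
- move=> j; apply: (@measurable_saturated N) => x y e [<- Ux].
  by split; [rewrite /numbered_cell/= e|exact: sU e Ux].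
- apply: trivIset_setIr => i j _ _ [x [/= <- <-]]//.
- move=> j.
  have [->|[x jx jE]] := numbered_cellVset0 N j.
    by rewrite set0I !setI0 !measure0 mule0.
  have [Ux|nUx] := pselect (U x).
    have -> : numbered_cell N j `&` U = cell N x.
      by rewrite jE setIidl// => y /esym e; exact: sU e Ux.
    exact: h.
  have -> : numbered_cell N j `&` U = set0.
    apply/seteqP; split=> // y []; rewrite jE => e Uy.
    by apply: nUx; exact: sU e Uy.
  by rewrite !setI0 !measure0 mule0.
Qed.

Lemma closed_cellE N x : mu (closed_cell N x) = ((l / 2 ^+ N) ^+ n)%:E.
Proof.
rewrite /closed_cell lebesgue_Rn_box; last first.
  by move=> i; rewrite lerDl divr_ge0// ltW// exprn_gt0.
rewrite (eq_bigr (fun=> l / 2 ^+ N)) ?prodr_const ?card_ord// => i _.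
by rewrite addrAC subrr add0r.
Qed.

Lemma sub_closed_cell N x : cell N x `<=` closed_cell N x.
Proof. by move=> y /cellP h i; have /andP[-> /ltW ->] := h i. Qed.

Lemma closed_cell_boundary N x : mu (closed_cell N x `\` cell N x) = 0%E.
Proof.
pose w := l / 2 ^+ N.
(* The upper face in direction [i]: a box whose side [i] is degenerate, so the product giving its
   measure has a zero factor. *)
pose face i : set (Rn R n) := [set y | forall j,
  (if j == i then corner N x i + w else corner N x j) <= tnth y j
   <= corner N x j + w].
have w0 : 0 <= w by rewrite divr_ge0// ltW.
have face0 i : mu (face i) = 0%E.
  rewrite /face lebesgue_Rn_box.
    by rewrite (bigD1 i)//= eqxx subrr mul0r.
  by move=> j; case: eqP => [->//|_]; rewrite lerDl.
apply/eqP; rewrite eq_le measure_ge0 andbT.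
have sub : closed_cell N x `\` cell N x `<=` \big[setU/set0]_(i < n) face i.
  move=> y [cy ncy]; apply: contrapT => nface; apply: ncy; apply/cellP => i.
  have /andP[-> h] := cy i; rewrite /= lt_neqAle h andbT.
  apply/eqP => e; apply: nface; rewrite (bigD1 i)//=; left => j.
  case: eqP => [->|_]; last exact: cy.
  by rewrite e lexx.
have mface i : measurable (face i) by exact: measurable_box.
have [mF F0] : measurable (\big[setU/set0]_(i < n) face i) /\
    mu (\big[setU/set0]_(i < n) face i) = 0%E.
  apply: (big_ind (fun U => measurable U /\ mu U = 0%E)) => //.
  by move=> U V [mU U0] [mV V0]; split; [exact: measurableU|rewrite measureU0].
rewrite -F0; apply: le_measure sub; rewrite inE//.
by apply: measurableD; [exact: measurable_closed_cell|exact: measurable_cell].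
Qed.

Lemma cellE N x : mu (cell N x) = ((l / 2 ^+ N) ^+ n)%:E.
Proof.
rewrite -(closed_cellE N x).
have -> : mu (closed_cell N x) = (mu (closed_cell N x `\` cell N x) +
    mu (closed_cell N x `&` cell N x))%E.
  apply: measureDI; [exact: measurable_closed_cell|exact: measurable_cell].
by rewrite closed_cell_boundary add0e setIidr//; exact: sub_closed_cell.
Qed.

(** * Approximation of measurable sets by unions of dyadic cells of one level *)

Definition approximable Q S := measurable S /\ forall e : R, 0 < e ->
  exists N U, saturated N U /\
    (mu (Q `&` ((S `\` U) `|` (U `\` S))) <= e%:E)%E.

Section approximable.
Variable Q : set (Rn R n).
Hypotheses (mQ : measurable Q) (Qoo : (mu Q < +oo)%E).

Lemma saturated_approximable N U : saturated N U -> approximable Q U.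
Proof.
move=> sU; split; first exact: measurable_saturated sU.
move=> e e0; exists N, U; split => //.
by rewrite setDv setU0 setI0 measure0 lee_fin ltW.
Qed.

Lemma approximableC S : approximable Q S -> approximable Q (~` S).
Proof.
move=> [mS aS]; split; first exact: measurableC.
move=> e /aS[N [U [sU h]]]; exists N, (~` U); split; first exact: saturatedC.
by rewrite !setDE !setCK setUC [~` U `&` _]setIC [~` S `&` _]setIC -!setDE.
Qed.

Lemma approximableU S S' : approximable Q S -> approximable Q S' ->
  approximable Q (S `|` S').
Proof.
move=> [mS aS] [mS' aS']; split; first exact: measurableU.
move=> e e0; have e20 : 0 < e / 2 by rewrite divr_gt0.
have [N [U [sU h]]] := aS _ e20; have [N' [U' [sU' h']]] := aS' _ e20.
have mU := measurable_saturated sU; have mU' := measurable_saturated sU'.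
exists (maxn N N'), (U `|` U'); split.
  by apply: saturatedU; [exact: (saturatedW (leq_maxl _ _) sU)|
    exact: (saturatedW (leq_maxr _ _) sU')].
have -> : e%:E = ((e / 2)%:E + (e / 2)%:E)%E by rewrite -EFinD -splitr.
apply: le_trans (leeD h h').
set A := Q `&` _; set B := Q `&` (S `\` U `|` _); set C := Q `&` _.
have mB : measurable B.
  by apply: measurableI => //; apply: measurableU; exact: measurableD.
have mC : measurable C.
  by apply: measurableI => //; apply: measurableU; exact: measurableD.
apply: le_trans (measureU2 mu mB mC); apply: le_measure; rewrite ?inE.
- apply: measurableI => //.
  by apply: measurableU; apply: measurableD; exact: measurableU.
- exact: measurableU.
move=> x [Qx [[[Sx|Sx] nU]|[[Ux|Ux] nS]]].
- by left; split => //; left; split => // ?; apply: nU; left.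
- by right; split => //; left; split => // ?; apply: nU; right.
- by left; split => //; right; split => // ?; apply: nS; left.
- by right; split => //; right; split => // ?; apply: nS; right.
Qed.

(** As [Q] has finite measure, continuity from above lets a finite union [T m] miss at most [e / 2]
    of the full union inside [Q]; approximating [T m] costs the other half. *)
Lemma approximable_bigcup (F : (set (Rn R n))^nat) :
  (forall i, approximable Q (F i)) -> approximable Q (\bigcup_i F i).
Proof.
move=> aF; have mF i : measurable (F i) by have [] := aF i.
have mbF : measurable (\bigcup_i F i) by exact: bigcupT_measurable.
split => // e e0; have e20 : 0 < e / 2 by rewrite divr_gt0.
pose T m := \big[setU/set0]_(i < m) F i.
have aT m : approximable Q (T m).
  rewrite /T; elim: m => [|m IH]; last first.
    by rewrite big_ord_recr/=; exact: approximableU.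
  by rewrite big_ord0; apply: (@saturated_approximable 0%N).
have mT m : measurable (T m) by have [] := aT m.
pose D m := Q `&` ((\bigcup_i F i) `\` T m).
have mD m : measurable (D m) by apply: measurableI => //; exact: measurableD.
have D0 : \bigcap_m D m = set0.
  apply/seteqP; split=> // x Dx.
  have [_ [[i _ Fix] _]] := Dx 0%N I.
  have [_ [_]] := Dx i.+1 I; apply.
  by rewrite /T big_ord_recr/=; right.
have [m mDe] : exists m, (mu (D m) <= (e / 2)%:E)%E.
  have cD : mu \o D @ \oo --> mu (\bigcap_m D m).
    apply: nonincreasing_cvg_mu => //.
    - apply: le_lt_trans Qoo; apply: le_measure; rewrite ?inE//.
      exact: subIsetl.
    - by rewrite D0.
    - move=> p q pq; apply/subsetPset; apply: setIS; apply: setDS.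
      exact: subset_bigsetU.
  have /cD : nbhs (mu (\bigcap_m D m)) [set x | (x < (e / 2)%:E)%E].
    rewrite D0 measure0; apply: open_nbhs_nbhs; split; last by rewrite /= lte_fin.
    exact: open_ereal_lt_ereal.
  by move=> [m _ /(_ m (leqnn m))/= /ltW]; exists m.
have [_ /(_ _ e20)[N [U [sU h]]]] := aT m.
have mU := measurable_saturated sU.
exists N, U; split => //.
have -> : e%:E = ((e / 2)%:E + (e / 2)%:E)%E by rewrite -EFinD -splitr.
apply: le_trans (leeD mDe h).
set B := Q `&` (T m `\` U `|` _).
have mB : measurable B.
  by apply: measurableI => //; apply: measurableU; exact: measurableD.
apply: le_trans (measureU2 mu (mD m) mB); apply: le_measure; rewrite ?inE.
- by apply: measurableI => //; apply: measurableU; apply: measurableD.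
- exact: measurableU.
move=> x [Qx [[Fx nU]|[Ux nF]]].
  have [Tx|nTx] := pselect (T m x); first by right; split => //; left.
  by left.
right; split => //; right; split => // Tx; apply: nF.
by move: Tx; rewrite /T -bigcup_mkord => -[i _ ?]; exists i.
Qed.

Lemma approximable_sigma_algebra : sigma_algebra setT (approximable Q).
Proof.
split.
- exact: (@saturated_approximable 0%N).
- by move=> A aA; rewrite setTD; exact: approximableC.
- exact: approximable_bigcup.
Qed.

(** The half-space is the increasing limit of the unions of cells lying strictly below the layer
    that contains [c]. *)
Lemma approximable_halfspace i (c : R) :
  approximable Q [set x : Rn R n | tnth x i < c].
Proof.
pose U N : set (Rn R n) := [set x | cell_code N x i < coordinate N c i].
have -> : [set x : Rn R n | tnth x i < c] = \bigcup_N U N.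
  apply/seteqP; split => [x /= xc|x [N _]]; last first.
    rewrite /U/= ffunE => lt; rewrite ltNge; apply/negP => cx.
    move: lt; rewrite ltNge => /negP; apply.
    by apply: le_floor; rewrite ler_pM2l ?exprn_gt0// ler_pM2r ?invr_gt0// lerD2r.
  pose d := (c - tnth x i) / l.
  have d0 : 0 < d by rewrite divr_gt0// subr_gt0.
  (* Once [2 ^+ N * d] is at least 1, the rescaled coordinates of [x] and [c] are at least 1 apart,
     so their floors differ. *)
  have [N Nd] : exists N : nat, d^-1 <= 2 ^+ N.
    exists (Num.truncn d^-1).+1; apply: ltW.
    apply: lt_le_trans (truncnS_gt _) _; rewrite -natrX ler_nat.
    exact: ltnW (ltn_expl _ _).
  exists N => //; rewrite /U/= ffunE -lezD1 /coordinate floor_ge_int intrD.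
  have : 1 <= 2 ^+ N * d by rewrite -ler_pdivrMr// div1r.
  have -> : 2 ^+ N * d = 2 ^+ N * ((c - a i) / l) - 2 ^+ N * ((tnth x i - a i) / l).
    by rewrite -mulrBr -mulrBl opprB addrA subrK.
  by have := floor_le (2 ^+ N * ((tnth x i - a i) / l)); lra.
by apply: approximable_bigcup => N; apply: (@saturated_approximable N) => x y;
  rewrite /U/= => ->.
Qed.

(** The sigma-algebra of tuples is generated by the coordinates. The real sets with approximable
    preimage under one coordinate form a sigma-algebra containing the open left rays, hence all
    Borel sets. *)
Lemma measurable_approximable S : measurable S -> approximable Q S.
Proof.
move=> mS; apply: (smallest_sub approximable_sigma_algebra _ mS).
apply: (big_ind (fun G => G `<=` approximable Q)) => //.
  by move=> G G' GQ G'Q A [/GQ|/G'Q].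
move=> i _ A [B mB <-].
have sB := sigma_algebra_image (fun x : Rn R n => tnth x i)
  approximable_sigma_algebra.
have mB' : (@RGenInftyO.G R).-sigma.-measurable B by rewrite -RGenInftyO.measurableE.
apply: (smallest_sub sB _ mB') => _ [c ->].
rewrite /image_set_system/= setTI.
have -> : (fun x : Rn R n => tnth x i) @^-1` `]-oo, c[ =
    [set x : Rn R n | tnth x i < c].
  by apply/seteqP; split=> x /=; rewrite in_itv.
exact: approximable_halfspace.
Qed.

End approximable.

(** * Dyadic density and the Calderon-Zygmund stopping cells *)

Definition half_dense G N x : Prop :=
  ((2^-1)%:E * mu (cell N x) < mu (G `&` cell N x))%E.

Lemma saturated_half_dense G N : saturated N [set x | half_dense G N x].
Proof. by move=> x y; rewrite /half_dense /cell /= => ->. Qed.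

Lemma measurable_never_half_dense G :
  measurable [set x | forall N, ~ half_dense G N x].
Proof.
rewrite (_ : [set x | _] = \bigcap_N ~` [set x | half_dense G N x]); last first.
  by apply/seteqP; split=> [x h N _|x h N]; exact: h.
apply: bigcap_measurable => // N _; apply: measurableC.
exact: measurable_saturated (@saturated_half_dense G N).
Qed.

(* A set meeting every cell in at most half of it is null, since it can be
   approximated by saturated sets. *)
Lemma dyadic_density (x0 : Rn R n) G : measurable G -> G `<=` cell 0 x0 ->
  mu (G `&` [set x | forall N, ~ half_dense G N x]) = 0%E.
Proof.
move=> mG GQ; set Q := cell 0 x0 in GQ *.
have mQ : measurable Q by exact: measurable_cell.
have Qoo : (mu Q < +oo)%E by rewrite cellE ltry.
set B := G `&` _.
have mB : measurable B.
  by apply: measurableI => //; exact: measurable_never_half_dense.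
have BQ : B `<=` Q by move=> x [/GQ].
(* A cell meeting [B] at [y] is the cell of [y], and [y] is never half dense, so already [G] fills
   at most half of it. *)
have Bhalf N x : (mu (B `&` cell N x) <= (2^-1)%:E * mu (cell N x))%E.
  have [->|/set0P[y [By e]]] := eqVneq (B `&` cell N x) set0.
    by rewrite measure0 mule_ge0// lee_fin.
  have cE : cell N x = cell N y by rewrite /cell e.
  have [_ /(_ N)/negP] := By; rewrite -leNgt cE; apply: le_trans.
  have mc := measurable_cell N y.
  apply: le_measure; rewrite ?inE; [exact: measurableI|exact: measurableI|].
  by apply: setSI => z [].
have Bfin : mu B \is a fin_num.
  rewrite ge0_fin_numE//; apply: le_lt_trans Qoo; apply: le_measure BQ; rewrite inE//.
(* If [U] approximates [B] within [e], then [mu B] is at most half of [mu (U]&[Q)] plus [e], hence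
   at most [(mu B + e) / 2 + e]. Solving for [mu B] gives the factor 3. *)
have key e : 0 < e -> fine (mu B) <= 3 * e.
  move=> e0.
  have [_ /(_ _ e0)[N [U [sU h]]]] := measurable_approximable mQ Qoo mB.
  have mU := measurable_saturated sU.
  set D := Q `&` _ in h.
  have mD : measurable D.
    by apply: measurableI => //; apply: measurableU; exact: measurableD.
  have mV : measurable (U `&` Q) by exact: measurableI.
  have sV : saturated N (U `&` Q).
    move=> x y e' [Ux Qx]; split; first exact: sU e' Ux.
    exact: (saturatedW (leq0n N) (@saturated_cell 0%N x0) e' Qx).
  have h1 : (mu (B `&` (U `&` Q)) <= (2^-1)%:E * mu (setT `&` (U `&` Q)))%E.
    by apply: (saturated_le sV) => // x _; rewrite setTI; exact: Bhalf.
  have h2 : (mu (U `&` Q) <= mu B + mu D)%E.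
    apply: le_trans (measureU2 mu mB mD); apply: le_measure; rewrite ?inE//.
      exact: measurableU.
    move=> x [Ux Qx]; have [Bx|nBx] := pselect (B x); [by left|right].
    by split => //; right.
  have h3 : (mu B <= mu (B `&` (U `&` Q)) + mu D)%E.
    have mBV : measurable (B `&` (U `&` Q)) by exact: measurableI.
    apply: le_trans (measureU2 mu mBV mD); apply: le_measure; rewrite ?inE//.
      exact: measurableU.
    move=> x Bx; have Qx := BQ _ Bx.
    have [Ux|nUx] := pselect (U x); [by left|right].
    by split => //; left.
  have : (mu B <= (2^-1)%:E * (mu B + e%:E) + e%:E)%E.
    apply: (le_trans h3); apply: leeD => //; apply: (le_trans h1).
    rewrite setTI lee_pmul2l// ?lte_fin ?invr_gt0//.
    by apply: (le_trans h2); exact: leeD.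
  rewrite -(fineK Bfin) -[X in (_ <= X)%E]/(2^-1 * (fine (mu B) + e) + e)%:E lee_fin; lra.
rewrite -(fineK Bfin); congr EFin; apply/eqP; rewrite eq_le fine_ge0// andbT.
apply/ler_addgt0Pr => e e0; rewrite add0r.
have e30 : 0 < e / 3 by rewrite divr_gt0.
by have := key _ e30; lra.
Qed.

(* The first half dense cell on the way down to a point has a parent which is
   not half dense, and has at least the fraction [2 ^- n] of its measure. *)
Lemma calderon_zygmund (x0 : Rn R n) G S (c : R) : measurable G ->
  measurable S -> S `<=` G -> G `<=` cell 0 x0 ->
  ~ half_dense G 0 x0 -> 0 <= c ->
  (forall N x, cell 0 x0 x -> ~ half_dense G N x ->
    mu (S `&` cell N x) <= c%:E * mu (cell N x))%E ->
  (mu S <= (c * 2 ^+ n * 2)%:E * mu G)%E.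
Proof.
move=> mG mS SG GQ ndense0 c0 hS.
(* The union of the cells selected at level [N]: the points whose first half dense cell has that
   level. *)
pose B N : set (Rn R n) := [set x | [/\ cell 0 x0 x, half_dense G N x &
  forall M, (M < N)%N -> ~ half_dense G M x]].
have sB N : saturated N (B N).
  move=> x y e [Qx dx nx]; split.
  - exact: (saturatedW (leq0n N) (@saturated_cell 0%N x0) e Qx).
  - exact: saturated_half_dense e dx.
  - move=> M MN; apply: (saturatedC (@saturated_half_dense G M)) (nx M MN).
    exact: cell_code_coarser (ltnW MN) e.
have mB N : measurable (B N) by exact: measurable_saturated (sB N).
have tB : trivIset setT B.
  move=> N M _ _ [x [[_ dN nN] [_ dM nM]]].
  by case: (ltngtP N M) => // [/nM|/nN].
(* The hypothesis is applied to the parent. Its measure is [2 ^+ n] times that of the selected cell,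
   which is in turn less than twice the part of it in [G]. *)
have step N x : B N x -> (mu (S `&` cell N x) <=
    (c * 2 ^+ n * 2)%:E * mu (G `&` cell N x))%E.
  case: N => [[Qx d0 _]|N [Qx dx nx]].
    by exfalso; apply: ndense0; apply: saturated_half_dense d0.
  have le1 : (mu (S `&` cell N.+1 x) <= mu (S `&` cell N x))%E.
    apply: le_measure; rewrite ?inE.
    - by apply: measurableI => //; exact: measurable_cell.
    - by apply: measurableI => //; exact: measurable_cell.
    - by apply: setIS => y; exact: cell_code_coarser.
  apply: (le_trans le1); apply: (le_trans (hS N x Qx (nx N _))) => //.
  move: dx; rewrite /half_dense !cellE.
  set g := mu (G `&` _); set w := l / 2 ^+ N.
  have -> : l / 2 ^+ N.+1 = w / 2 by rewrite /w exprS invfM mulrCA mulrC.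
  have gfin : g \is a fin_num.
    rewrite ge0_fin_numE ?measure_ge0//; apply: (@le_lt_trans _ _ (mu (cell N.+1 x))).
      by apply: le_measure; rewrite ?inE; [apply: measurableI => //| |];
        rewrite ?cellE ?ltry//; exact: measurable_cell.
    by rewrite cellE ltry.
  rewrite -(fineK gfin) -!EFinM lte_fin lee_fin expr_div_n => hg.
  rewrite -[leRHS]mulrA -mulrA ler_wpM2l//.
  have p : 0 < 2 ^+ n :> R by rewrite exprn_gt0.
  have -> : w ^+ n = 2 ^+ n * (2 * (2^-1 * (w ^+ n / 2 ^+ n))).
    by rewrite mulVKf// mulrC divfK// gt_eqF.
  by rewrite ler_pM2l// ler_pM2l// ltW.
have le2 : (mu (S `&` \bigcup_N B N) <=
    (c * 2 ^+ n * 2)%:E * mu (G `&` \bigcup_N B N))%E.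
  by apply: measure_le_partition => // N; exact: (saturated_le (sB N) mS mG (step N)).
have mbB : measurable (\bigcup_N B N) by exact: bigcupT_measurable.
have S0 : mu (S `\` \bigcup_N B N) = 0%E.
  apply/eqP; rewrite eq_le measure_ge0 andbT -(dyadic_density mG GQ).
  apply: le_measure; rewrite ?inE.
  - exact: measurableD.
  - by apply: measurableI => //; exact: measurable_never_half_dense.
  - move=> x [Sx nBx]; split; first exact: SG.
    move=> N dN; apply: nBx.
    have exd : exists N, `[< half_dense G N x >] by exists N; exact/asboolP.
    case: (ex_minnP exd) => M /asboolP dM minM; exists M => //; split => //.
      exact/GQ/SG.
    move=> K KM /asboolP/minM; by rewrite leqNgt KM.
have -> : mu S = (mu (S `\` \bigcup_N B N) + mu (S `&` \bigcup_N B N))%E.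
  exact: measureDI.
rewrite S0 add0e; apply: (le_trans le2); apply: lee_wpmul2l.
  by rewrite lee_fin !mulr_ge0// exprn_ge0.
by apply: le_measure; rewrite ?inE//; exact: measurableI.
Qed.

End dyadic.

(** * Rearrangements and the sharp maximal function *)

Section rearrangement_theory.
Context d (T : measurableType d) (R : realType).
Variables (mu : {measure set T -> \bar R}) (D : set T).
Hypotheses (mD : measurable D) (Doo : (mu D < +oo)%E).
Implicit Types (f : T -> R) (s t u : R).

Local Notation levels f t := [set u : R | 0 <= u /\
  (mu (D `&` [set x | (u < `|f x|)%R]) <= t%:E)%E].

Lemma measurable_superlevel f u : measurable_fun D f ->
  measurable (D `&` [set x | (u < `|f x|)%R]).
Proof.
move=> mf; have mnf : measurable_fun D (fun x => `|f x|).
  exact: measurableT_comp.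
have := mnf mD `]u, +oo[%classic (measurable_itv _).
by rewrite (_ : _ @^-1` _ = [set x | u < `|f x|])//;
  apply/seteqP; split=> x /=; rewrite in_itv/= andbT.
Qed.

Lemma rearrangement_le f t u : 0 <= u ->
  (mu (D `&` [set x | (u < `|f x|)%R]) <= t%:E)%E -> rearrangement mu D f t <= u.
Proof. by move=> u0 hu; apply: ge_inf => //; exists 0 => v []. Qed.

(** The sets where [|f|] exceeds [k] decrease to the empty set inside [D], which has finite measure.
    This ensures that [inf] in [rearrangement] is a true infimum and not its default value. *)
Lemma levels_nonempty f t : measurable_fun D f -> 0 < t -> levels f t !=set0.
Proof.
move=> mf t0; pose E k := D `&` [set x | (k%:R < `|f x|)%R].
have mE k : measurable (E k) by exact: measurable_superlevel.
have E0 : \bigcap_k E k = set0.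
  apply/seteqP; split=> // x Ex.
  have [_ /=] := Ex (Num.truncn `|f x|).+1 I.
  by rewrite ltNge => /negP; apply; apply/ltW/truncnS_gt.
have cE : mu \o E @ \oo --> mu (\bigcap_k E k).
  apply: nonincreasing_cvg_mu => //.
  - by apply: le_lt_trans Doo; apply: le_measure; rewrite ?inE//; exact: subIsetl.
  - by rewrite E0.
  - move=> p q pq; apply/subsetPset; apply: setIS => x /=.
    by apply: le_lt_trans; rewrite ler_nat.
have /cE : nbhs (mu (\bigcap_k E k)) [set x | (x < t%:E)%E].
  rewrite E0 measure0; apply: open_nbhs_nbhs; split; last by rewrite /= lte_fin.
  exact: open_ereal_lt_ereal.
by move=> [m _ /(_ m (leqnn m))/= /ltW h]; exists m%:R; split.
Qed.

Lemma rearrangement_ge0 f t : 0 <= rearrangement mu D f t.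
Proof.
rewrite /rearrangement; set E := [set _ | _].
have [->|/set0P E0] := eqVneq E set0; first by rewrite inf0.
by apply: lb_le_inf => // u [].
Qed.

Lemma rearrangement_lt f t u : measurable_fun D f -> 0 < t ->
  rearrangement mu D f t < u -> (mu (D `&` [set x | (u < `|f x|)%R]) <= t%:E)%E.
Proof.
move=> mf t0 /inf_lt[|v [v0 hv] vu]; first exact: levels_nonempty.
apply: le_trans hv; apply: le_measure; rewrite ?inE.
- exact: measurable_superlevel.
- exact: measurable_superlevel.
- by apply: setIS => x /=; exact: lt_trans.
Qed.

Lemma rearrangement_nonincreasing f s t : measurable_fun D f -> 0 < s ->
  s <= t -> rearrangement mu D f t <= rearrangement mu D f s.
Proof.
move=> mf s0 st; apply: lb_le_inf; first exact: levels_nonempty.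
move=> u [u0 hu]; apply: rearrangement_le => //.
by apply: le_trans hu _; rewrite lee_fin.
Qed.

End rearrangement_theory.

Lemma integral_markov d (T : measurableType d) (R : realType)
    (mu : {measure set T -> \bar R}) (Q A : set T) (g : T -> R) (b : R) :
  measurable Q -> measurable A -> A `<=` Q -> measurable_fun Q g -> 0 < b ->
  (forall x, A x -> b <= `|g x|) ->
  (b%:E * mu A <= \int[mu]_(x in Q) `|(g x)%:E|)%E.
Proof.
move=> mQ mA AQ mg b0 hb.
have mEg : measurable_fun Q (EFin \o g) by exact/measurable_EFinP.
have := @le_integral_abse _ _ _ mu Q mQ (EFin \o g) b mEg b0.
apply: le_trans; rewrite lee_pmul2l ?lte_fin//.
apply: le_measure; rewrite ?inE//; last first.
  by move=> x Ax; split; [exact: AQ|rewrite /= lee_fin; exact: hb].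
rewrite (_ : _ `&` _ = Q `&` [set x | (b%:E <= (abse \o (EFin \o g)) x)%E])//.
apply: emeasurable_fun_c_infty => //.
exact: measurableT_comp.
Qed.

(** Chebyshev's inequality is used twice: on [A], which is at least half of [Q], it puts [c] within
    [l + 2 * h] of the origin; then [|f|] above the stated level forces [|f - c|] to be at least
    [K * h]. *)
Lemma oscillation_tail d (T : measurableType d) (R : realType)
    (mu : {measure set T -> \bar R}) (Q A : set T) (f : T -> R)
    (c q h l K : R) :
  measurable Q -> measurable A -> A `<=` Q -> measurable_fun Q f ->
  mu Q = q%:E -> 0 < q -> 0 < h -> 0 < K ->
  (\int[mu]_(x in Q) `|(f x - c)%:E| <= (h * q)%:E)%E ->
  ((2^-1 * q)%:E <= mu A)%E -> (forall x, A x -> `|f x| <= l) ->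
  (mu (Q `&` [set x | (l + (2 + K) * h < `|f x|)%R]) <= (K^-1 * q)%:E)%E.
Proof.
move=> mQ mA AQ mf Qq q0 h0 K0 If Aq fl.
have mfc : measurable_fun Q (fun x => f x - c) by exact: measurable_funB.
have cl : `|c| <= l + 2 * h.
  rewrite leNgt; apply/negP => lc.
  have b0 : 0 < `|c| - l by lra.
  have := @integral_markov _ _ _ mu Q A _ _ mQ mA AQ mfc b0.
  have tri x : A x -> `|c| - l <= `|f x - c|.
    move=> /fl fx; have := lerB_dist c (f x); rewrite distrC; lra.
  move=> /(_ tri) /le_trans /(_ If) hA.
  have : ((`|c| - l)%:E * (2^-1 * q)%:E <= (h * q)%:E)%E.
    by apply: le_trans hA; rewrite lee_pmul2l ?lte_fin.
  rewrite -EFinM lee_fin; nra.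
set S := Q `&` _.
have mS : measurable S by exact: measurable_superlevel.
have SQ : S `<=` Q by exact: subIsetl.
have Kh0 : 0 < K * h by exact: mulr_gt0.
have triS x : S x -> K * h <= `|f x - c|.
  by move=> [_ /= fx]; have := lerB_dist (f x) c; lra.
have := @integral_markov _ _ _ mu Q S _ _ mQ mS SQ mfc Kh0 triS.
move=> /le_trans /(_ If) hS.
rewrite -(@lee_pmul2l _ (K * h)%:E) ?lte_fin//; apply: (le_trans hS).
by rewrite -EFinM mulrACA mulfV ?mul1r// gt_eqF.
Qed.

(** * The sharp maximal function on dyadic cells and the rearrangement inequality *)

Section sharp.
Context {R : realType} (n : nat) (a : 'I_n -> R) (l : R).
Hypothesis l0 : 0 < l.
Local Notation mu := (lebesgue_Rn R n).
Local Notation cell := (cell a l).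
Local Notation closed_cell := (closed_cell a l).

Lemma closed_cell_root N (x0 x : Rn R n) : cell 0 x0 x ->
  closed_cell N x `<=` closed_cell 0 x0.
Proof.
move=> x0x y h i; have := h i.
have p : 0 < 2 ^+ N :> R by rewrite exprn_gt0.
rewrite /corner -(x0x : cell_code a l 0 x = _) expr0 divr1.
set k := cell_code a l 0 x i; set m := cell_code a l N x i.
(* The children of a cell with integer coordinate [k] have coordinates from [2 ^+ N * k] to
   [2 ^+ N * (k + 1) - 1]; the last bound uses that [m] is an integer. *)
have [km mk] : 2 ^+ N * k%:~R <= m%:~R :> R /\ m%:~R + 1 <= 2 ^+ N * (k%:~R + 1) :> R.
  rewrite /m /k !ffunE /coordinate expr0 mul1r; set z := _ / l.
  have -> : 2 ^+ N = ((2 ^ N)%N%:Z)%:~R :> R by rewrite -natrX pmulrn.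
  have P : 0 < ((2 ^ N)%N%:Z)%:~R :> R by rewrite ltr0z ltz_nat expn_gt0.
  rewrite -[1]/(1%:~R) -!intrD -!intrM !ler_int lezD1.
  split; first by rewrite floor_ge_int intrM ler_pM2l ?floor_le.
  by rewrite floor_lt_int intrM ltr_pM2l ?floorD1_gt.
set w := l / 2 ^+ N; have lw : l = w * 2 ^+ N by rewrite divfK// gt_eqF.
have w0 : 0 < w by rewrite divr_gt0.
rewrite [in X in _ -> X]lw.
have := ler_wpM2l (ltW w0) km; have := ler_wpM2l (ltW w0) mk; lra.
Qed.

Lemma closed_cell_cube N (x : Rn R n) : is_cube (closed_cell N x).
Proof. by exists (corner a l N x), (l / 2 ^+ N); split; rewrite ?divr_gt0 ?exprn_gt0. Qed.

Lemma sharp_maximal_oscillation (Q0 Q : set (Rn R n)) (f : Rn R n -> R) x (q h : R) :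
  mu.-integrable Q0 (EFin \o f) -> measurable Q0 -> measurable Q ->
  Q `<=` Q0 -> is_cube Q -> mu Q = q%:E -> 0 < q -> Q x ->
  (sharp_maximal Q0 f x <= h%:E)%E ->
  (\int[mu]_(y in Q) `|(f y - mean Q f)%:E| <= (h * q)%:E)%E.
Proof.
move=> intf mQ0 mQ QQ0 cQ Qq q0 Qx shx.
have intQ : mu.-integrable Q (EFin \o f) by exact: integrableS intf.
have intc : mu.-integrable Q (EFin \o (fun y => f y - mean Q f)).
  apply: (@integrableB _ _ _ mu Q mQ (EFin \o f) (fun=> (mean Q f)%:E)) => //.
  apply/integrableP; split; first exact: measurable_cst.
  by rewrite integral_cst// [X in (_ * X)%E]Qq -EFinM ltry.
(* [mean] takes the real part of an integral, which would turn an infinite value into 0; finiteness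
   makes the bound meaningful. *)
have Ifin := integrable_fin_num mQ (integrable_abse intc).
have : ((mean Q (fun y => `|f y - mean Q f|))%:E <= h%:E)%E.
  by apply: le_trans shx; apply: ereal_sup_ubound; exists Q.
rewrite {1}/mean Qq/= lee_fin ler_pdivrMl// mulrC => hI.
by rewrite -(fineK Ifin) lee_fin.
Qed.

Section weak_type.
Variables (x0 : Rn R n) (f h : Rn R n -> R).
Let Q0 := closed_cell 0 x0.
Hypotheses (Q01 : mu Q0 = 1%:E) (intf : mu.-integrable Q0 (EFin \o f))
  (mh : measurable_fun Q0 h)
  (fh : {ae mu, forall x, Q0 x -> sharp_maximal Q0 f x = (h x)%:E}).

Let mQ0 : measurable Q0. Proof. exact: measurable_closed_cell. Qed.
Let mf : measurable_fun Q0 f.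
Proof. by have /integrableP[/measurable_EFinP] := intf. Qed.

Lemma level_set_le (t u v : R) : 0 < t -> t <= 8^-1 -> 0 <= u -> 0 < v ->
  (mu (Q0 `&` [set x | (u < `|f x|)%R]) <= (2 * t)%:E)%E ->
  (mu (Q0 `&` [set x | (v < `|h x|)%R]) <= (2 * t)%:E)%E ->
  (mu (Q0 `&` [set x | (u + (2 + 8 * 2 ^+ n) * v < `|f x|)%R]) <= t%:E)%E.
Proof.
move=> t0 t8 u0 v0 fu hv.
(* Chosen so that the covering constant [K^-1 * 2 ^+ n * 2] times the bound [4 * t] on the measure
   of [G] is exactly [t]. *)
set K := 8 * 2 ^+ n; have K0 : 0 < K by rewrite mulr_gt0 ?exprn_gt0.
set L := u + _.
have mQ : measurable (cell 0 x0) by exact: measurable_cell.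
have QQ0 : cell 0 x0 `<=` Q0 by exact: sub_closed_cell.
pose E := Q0 `&` [set x | u < `|f x|]; pose F := Q0 `&` [set x | v < `|h x|].
pose H := Q0 `&` [set x | L < `|f x|].
have mE : measurable E by exact: measurable_superlevel.
have mF : measurable F by exact: measurable_superlevel.
have mH : measurable H by exact: measurable_superlevel.
pose G := cell 0 x0 `&` (E `|` F); pose S := cell 0 x0 `&` H.
have mG : measurable G by apply: measurableI => //; exact: measurableU.
have mS : measurable S by exact: measurableI.
have cell1 : mu (cell 0 x0) = 1%:E.
  by move: Q01; rewrite /Q0 closed_cellE// cellE.
have G4t : (mu G <= (4 * t)%:E)%E.
  apply: (@le_trans _ _ (mu (E `|` F))).
    by apply: le_measure; rewrite ?inE//; [exact: measurableU|exact: subIsetr].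
  apply: le_trans (measureU2 mu mE mF) _.
  have -> : (4 * t)%:E = ((2 * t)%:E + (2 * t)%:E)%E by rewrite -EFinD; congr EFin; lra.
  exact: leeD.
(* Restricting to the half-open root cell discards only part of its null boundary. *)
have HS : mu H = mu S.
  have -> : mu H = (mu (H `\` cell 0 x0) + mu (H `&` cell 0 x0))%E by exact: measureDI.
  rewrite setIC; suff -> : mu (H `\` cell 0 x0) = 0%E by rewrite add0e.
  apply/eqP; rewrite eq_le measure_ge0 andbT -(closed_cell_boundary a l0 0 x0).
  apply: le_measure; rewrite ?inE; [exact: measurableD|exact: measurableD|].
  by apply: setSD => y [].
have SG : S `<=` G.
  move=> y [Qy [Q0y Ly]]; split => //; left; split => //; apply: le_lt_trans Ly.
  by rewrite lerDl mulr_ge0 ?addr_ge0 ?ltW.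
rewrite -/H HS; apply: (@le_trans _ _ ((K^-1 * 2 ^+ n * 2)%:E * (4 * t)%:E)%E); last first.
  have -> : K^-1 * 2 ^+ n = 8^-1.
    by rewrite /K invfM mulfVK// expf_neq0.
  by rewrite -EFinM lee_fin; lra.
have K0' : 0 <= K^-1 by rewrite invr_ge0 ltW.
apply: (@le_trans _ _ ((K^-1 * 2 ^+ n * 2)%:E * mu G)%E); last first.
  by apply: lee_wpmul2l => //; rewrite lee_fin !mulr_ge0// exprn_ge0.
apply: (calderon_zygmund l0 mG mS SG _ _ K0').
- exact: subIsetl.
(* Here [t <= 8^-1] enters: [4 * t] is at most half the measure of the root. *)
- rewrite /half_dense cell1 mule1; apply/negP; rewrite -leNgt.
  rewrite setIidl; last exact: subIsetl.
  by apply: (le_trans G4t); rewrite lee_fin; lra.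
move=> N x Qx /negP; rewrite -leNgt => ndG.
pose w := (l / 2 ^+ N) ^+ n.
have w0 : 0 < w by rewrite exprn_gt0// divr_gt0 ?exprn_gt0.
have mc := measurable_cell a l0 N x.
have ccE : mu (closed_cell N x) = w%:E by exact: closed_cellE.
have cE : mu (cell N x) = w%:E by exact: cellE.
have mcc : measurable (closed_cell N x) by exact: measurable_closed_cell.
have ccQ0 : closed_cell N x `<=` Q0 by exact: closed_cell_root.
have cQ : cell N x `<=` cell 0 x0.
  by move=> y /(cell_code_coarser (leq0n N)) e; exact: (etrans e Qx).
have ccc : cell N x `<=` closed_cell N x by exact: sub_closed_cell.
pose A := cell N x `\` G.
have mA : measurable A by exact: measurableD.
have Aw : ((2^-1 * w)%:E <= mu A)%E.
  have : mu (cell N x) = (mu A + mu (cell N x `&` G))%E by exact: measureDI.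
  move: ndG; rewrite cE setIC; set g := mu (_ `&` _) => gw.
  have gfin : g \is a fin_num.
    by rewrite ge0_fin_numE ?measure_ge0//; apply: le_lt_trans gw _; rewrite -EFinM ltry.
  have Afin : mu A \is a fin_num.
    rewrite ge0_fin_numE//; apply: (@le_lt_trans _ _ (mu (cell N x))).
      by apply: le_measure; rewrite ?inE//; exact: subDsetl.
    by rewrite cE ltry.
  move: gw; rewrite -(fineK gfin) -(fineK Afin) -EFinM -EFinD !lee_fin => gw [].
  lra.
have Au y : A y -> `|f y| <= u /\ `|h y| <= v.
  move=> [cy nG]; have Qy := cQ _ cy; have Q0y := QQ0 _ Qy.
  by split; rewrite leNgt; apply/negP => lt; apply: nG; split => //; [left|right].
(* [A] has positive measure, so it meets the set of full measure on which [h] is the sharp maximal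
   function. *)
have [y Ay shy] : exists2 y, A y & sharp_maximal Q0 f y = (h y)%:E.
  apply: contrapT => nex; have [Z [mZ Z0 hZ]] := fh.
  have AZ : A `<=` Z.
    move=> y Ay; apply: hZ => /= e; apply: nex; exists y => //; apply: e.
    by apply/QQ0/cQ; case: Ay.
  have : (mu A <= mu Z)%E by apply: le_measure; rewrite ?inE.
  rewrite Z0 => /(le_trans Aw); rewrite lee_fin; nra.
have AQ : A `<=` closed_cell N x by move=> z [/ccc].
have shyv : (sharp_maximal Q0 f y <= v%:E)%E.
  by rewrite shy lee_fin (le_trans (ler_norm _))//; have [] := Au _ Ay.
have osc := sharp_maximal_oscillation intf mQ0 mcc ccQ0 (closed_cell_cube N x)
  ccE w0 (AQ _ Ay) shyv.
have mfc : measurable_fun (closed_cell N x) f by exact: measurable_funS mf.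
have fA z : A z -> `|f z| <= u by move=> /Au[].
have := oscillation_tail mcc mA AQ mfc ccE w0 v0 K0 osc Aw fA.
rewrite cE -EFinM; apply: le_trans; apply: le_measure; rewrite ?inE.
- exact: measurableI.
- exact: measurable_superlevel.
- by move=> z [[_ [_ ?]] /ccc].
Qed.

Lemma rearrangement_sharp_le (t : R) : 0 < t -> t <= 8^-1 ->
  rearrangement mu Q0 f t <= rearrangement mu Q0 f (2 * t) +
    (2 + 8 * 2 ^+ n) * rearrangement mu Q0 h (2 * t).
Proof.
move=> t0 t8; have t20 : 0 < 2 * t by rewrite mulr_gt0.
have Q0oo : (mu Q0 < +oo)%E by rewrite Q01 ltry.
set C := 2 + _; set rf := rearrangement _ _ f (2 * t).
set rh := rearrangement _ _ h _.
have C0 : 0 < C by rewrite addr_gt0// mulr_gt0// exprn_gt0.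
(* Both levels are raised by [s], which makes them admissible and the second one positive; the total
   cost [s + C * s] is [e]. *)
apply/ler_addgt0Pr => e e0; pose s := e / (1 + C).
have s0 : 0 < s by rewrite divr_gt0// addr_gt0.
have -> : rf + C * rh + e = (rf + s) + C * (rh + s).
  have : s * (1 + C) = e by rewrite divfK// gt_eqF// addr_gt0.
  lra.
have rf0 : 0 <= rf by exact: rearrangement_ge0.
have rh0 : 0 <= rh by exact: rearrangement_ge0.
apply: rearrangement_le.
  by rewrite addr_ge0 ?mulr_ge0// ?addr_ge0// ltW.
apply: level_set_le => //.
- by rewrite addr_ge0// ltW.
- by rewrite ltr_wpDl.
- by apply: rearrangement_lt => //; rewrite ltrDl.
- by apply: rearrangement_lt => //; rewrite ltrDl.
Qed.

End weak_type.
End sharp.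

(** * Dilations and the lower Boyd index *)

Section nonincreasing_functions.
Context {R : realType}.
Local Notation leb := (@lebesgue_measure R).
Local Notation I01 := (@unit_itv R).
Implicit Types (phi : R -> R) (s t u : R).

Definition decreasing_profile phi :=
  (forall t, 0 <= phi t) /\ (forall s t, 0 < s -> s <= t -> phi t <= phi s).

Lemma measurable_unit_itv : measurable I01.
Proof. exact: measurable_itv. Qed.

Lemma unit_itv_finite : (leb I01 < +oo)%E.
Proof. by rewrite /unit_itv lebesgue_measure_itv/= lte_fin ltr01 ltry. Qed.

(** By monotonicity the superlevel sets in the unit interval are intervals. *)
Lemma measurable_decreasing_profile phi : decreasing_profile phi ->
  measurable_fun I01 phi.
Proof.
move=> [_ phi_ni]; apply: (measurability (@RGenCInfty.G R)).
  exact: RGenCInfty.measurableE.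
move=> /= _ [_] [r] -> <-; apply: is_interval_measurable => s t/=.
rewrite /unit_itv/= !in_itv/= !andbT => -[/andP[s0 s1] hs] [/andP[t0 t1] ht] u.
move=> /andP[su ut]; rewrite !in_itv/= andbT.
rewrite (lt_le_trans s0 su) (le_lt_trans ut t1); split=> //.
by apply: (le_trans ht); apply: phi_ni => //; exact: lt_le_trans su.
Qed.

Lemma rearrangement_profile_le phi u : decreasing_profile phi -> 0 < u ->
  rearrangement leb I01 phi u <= phi u.
Proof.
move=> dphi u0; have [phi0 phi_ni] := dphi.
apply: rearrangement_le => //.
apply: (@le_trans _ _ (leb `]0, u[%classic)).
  apply: le_measure; rewrite ?inE.
  - apply: (@measurable_superlevel _ _ _ _ measurable_unit_itv).
    exact: measurable_decreasing_profile.
  - exact: measurable_itv.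
  - move=> t []; rewrite /unit_itv/= !in_itv/= => /andP[t0 t1].
    rewrite ger0_norm// t0/= => lt; rewrite ltNge; apply/negP => ut.
    by move: lt; rewrite ltNge phi_ni.
by rewrite lebesgue_measure_itv/= lte_fin u0 sube0.
Qed.

(** A profile may differ from its own rearrangement at jumps. Doubling the argument avoids one-sided
    limits: a level below [phi (2 * u)] is exceeded on an interval of length [2 * u]. *)
Lemma rearrangement_profile_ge phi u : decreasing_profile phi -> 0 < u ->
  2 * u < 1 -> phi (2 * u) <= rearrangement leb I01 phi u.
Proof.
move=> dphi u0 u1; have [phi0 phi_ni] := dphi.
have mphi := measurable_decreasing_profile dphi.
apply: lb_le_inf.
  exact: (levels_nonempty measurable_unit_itv unit_itv_finite).
move=> v [v0 hv]; rewrite leNgt; apply/negP => vphi.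
have : (leb `]0%R, (2 * u)%R[%classic <= u%:E)%E.
  apply: le_trans hv; apply: le_measure; rewrite ?inE.
  - exact: measurable_itv.
  - exact: (@measurable_superlevel _ _ _ _ measurable_unit_itv).
  - move=> t; rewrite /unit_itv/= !in_itv/= => /andP[t0 t1].
    rewrite t0 (lt_trans t1 u1) ger0_norm//; split=> //.
    by apply: (lt_le_trans vphi); exact: phi_ni (ltW t1).
rewrite lebesgue_measure_itv/= lte_fin mulr_gt0// sube0 lee_fin; lra.
Qed.

Lemma decreasing_profile_dilation phi (s : R) : decreasing_profile phi ->
  0 < s -> decreasing_profile (dilation s phi).
Proof.
move=> dphi s0; have [phi0 phi_ni] := dphi.
have mphi := measurable_decreasing_profile dphi.
have ge0 t : 0 <= dilation s phi t.
  by rewrite /dilation; case: ifP => // _; exact: rearrangement_ge0.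
split=> // t u t0 tu; rewrite {1}/dilation; case: ifP => [/andP[u0 us]|_].
  rewrite /dilation t0 (le_lt_trans tu us)/=.
  apply: (rearrangement_nonincreasing measurable_unit_itv unit_itv_finite) => //.
    by rewrite divr_gt0.
  by rewrite ler_pM2r ?invr_gt0.
exact: ge0.
Qed.

Lemma dilation_profile_le phi (s : R) t : decreasing_profile phi -> 0 < s ->
  s <= 1 -> dilation s phi t <= phi t.
Proof.
move=> dphi s0 s1; have [phi0 phi_ni] := dphi; rewrite /dilation.
case: ifP => [/andP[t0 ts]|_//].
apply: (le_trans (rearrangement_profile_le dphi _)); first by rewrite divr_gt0.
by apply: phi_ni => //; rewrite ler_pdivlMr// ler_piMr// ltW.
Qed.

(** The dilation evaluates the rearrangement of [phi] at [2 ^+ k * t]; the extra doubling in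
    [2 ^+ k.+1] absorbs the loss in [rearrangement_profile_ge]. *)
Lemma dilation_profile_ge phi k t : decreasing_profile phi -> 0 < t ->
  2 ^+ k * t <= 8^-1 -> phi (2 ^+ k.+1 * t) <= dilation (2 ^- k) phi t.
Proof.
move=> dphi t0 kt; have p : 0 < 2 ^+ k :> R by rewrite exprn_gt0.
have -> : 2 ^+ k.+1 * t = 2 * (2 ^+ k * t) by rewrite exprS mulrA.
rewrite /dilation t0/=.
have -> : t < 2 ^- k by rewrite -[ltRHS]mul1r ltr_pdivlMr// mulrC; lra.
by rewrite invrK [t * _]mulrC; apply: rearrangement_profile_ge => //;
  [rewrite mulr_gt0|lra].
Qed.

(** Induction on the number of doublings needed to pass [8^-1]. The sum keeps only the scales at
    which the one-step inequality is available, and passing from [2 * t] to [t] shifts its index by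
    one. *)
Lemma doubling_iteration (phi psi : R -> R) (C : R) (K : nat) (t : R) :
  0 <= C -> (forall s, 0 <= psi s) ->
  (forall s u, 0 < s -> s <= u -> phi u <= phi s) ->
  (forall s, 0 < s -> s <= 8^-1 -> phi s <= phi (2 * s) + C * psi (2 * s)) ->
  0 < t -> 8^-1 < 2 ^+ K * t ->
  phi t <= phi 8^-1 +
    C * \sum_(k < K | 2 ^+ k * t <= 8^-1) psi (2 ^+ k.+1 * t).
Proof.
move=> C0 psi0 phi_ni step; elim: K t => [|K IH] t t0.
  by rewrite expr0 mul1r big_ord0 mulr0 addr0 => h; exact/phi_ni/ltW.
move=> h; have [t8|t8] := leP t 8^-1; last first.
  apply: (le_trans (phi_ni 8^-1 t _ (ltW t8))); first by rewrite invr_gt0.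
  by rewrite lerDl mulr_ge0// sumr_ge0.
have t20 : 0 < 2 * t by rewrite mulr_gt0.
apply: (le_trans (step _ t0 t8)).
have := IH _ t20; rewrite mulrA -exprSr => /(_ h) IHt.
have e k : 2 ^+ k * (2 * t) = 2 ^+ k.+1 * t by rewrite mulrA -exprSr.
rewrite big_mkcond big_ord_recl/= expr0 mul1r t8 expr1.
move: IHt; rewrite big_mkcond/=.
under eq_bigr do rewrite !e.
by rewrite mulrDr; lra.
Qed.

End nonincreasing_functions.

(** Along [s = 2 ^- k] the quotient defining the index eventually exceeds half its limit [L], so the
    dilation norm is below [r ^+ k] with [r] equal to 2 to the power [- L / 2]. *)
Lemma dilation_norm_geometric (R : realType)
    (Xbar : function_space (measurableTypeR R) R) :
  0 < lower_boyd_index Xbar ->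
  exists r : R, [/\ 0 < r, r < 1 & exists k0 : nat, forall k f, (k0 <= k)%N ->
    carrier Xbar f -> fnorm Xbar f <= 1 ->
    fnorm Xbar (dilation (2 ^- k) f) <= r ^+ k].
Proof.
rewrite /lower_boyd_index; set g := fun s => ln (dilation_norm Xbar s) / ln s.
set F := _ @ _; set L := lim F => L0.
(* The limit operator returns [0] on a filter without limit. *)
have cF : cvg F by apply: cvgNpoint; rewrite gt_eqF.
have cg : g (2 ^- k) @[k --> \oo] --> L.
  have /(cvg_at_rightP g 0 L) : g x @[x --> 0^'+] --> L by exact: cF.
  apply; split; first by move=> k; rewrite invr_gt0 exprn_gt0.
  rewrite (_ : (fun k => 2 ^- k) = GRing.exp (2^-1 : R)).
    by apply: cvg_expr; rewrite ger0_norm ?invr_ge0// invf_lt1// ltr1n.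
  by apply/funext => k; rewrite exprVn.
have L20 : 0 < L / 2 by rewrite divr_gt0.
have ln2 : 0 < ln 2 :> R by rewrite ln_gt0// ltr1n.
exists (expR (- (L / 2 * ln 2))); split; first exact: expR_gt0.
  by rewrite expR_lt1 oppr_lt0 mulr_gt0.
have /cvgrPdist_lt /(_ _ L20)[k0 _ hk0] := cg.
(* [k = 0] is excluded because [ln 1 = 0] stands in the denominator. *)
exists (maxn 1 k0) => k f; rewrite geq_max => /andP[k1 k0k] cf f1.
have lns : ln (2 ^- k) = - (k%:R * ln 2) :> R.
  by rewrite lnV ?posrE ?exprn_gt0// lnXn// mulr_natl.
have kln : 0 < k%:R * ln 2 :> R by rewrite mulr_gt0// ltr0n.
have := hk0 k k0k; rewrite /g/= lns => /(le_lt_trans (ler_norm _)) hL.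
set N := dilation_norm Xbar (2 ^- k) in hL.
have lnN : ln N < - (L / 2 * ln 2) * k%:R.
  move: hL; rewrite ltrBlDr -ltrBlDl.
  have -> : L - L / 2 = L / 2 by lra.
  rewrite invrN mulrN ltrNr ltr_pdivrMr//; lra.
(* [ln] is 0 at nonpositive numbers and [sup] is 0 when no supremum exists. Since [ln N] is
   negative, [N] is positive and thus a true supremum. *)
have N0 : 0 < N.
  rewrite ltNge; apply/negP => /ln0 e; move: lnN; rewrite e.
  by have := mulr_gt0 L20 kln; lra.
have hsup : has_sup [set fnorm Xbar (dilation (2 ^- k) f) | f in
        [set f | carrier Xbar f /\ fnorm Xbar f <= 1]].
  apply: contrapT => /sup_out e.
  by move: N0; rewrite /N /dilation_norm e ltxx.
apply: (@le_trans _ _ N).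
  by apply: ub_le_sup; [case: hsup|exists f].
rewrite -expRM_natr -[leLHS]lnK ?posrE// ler_expR; exact: ltW.
Qed.

(** * Monotone limits and series in Banach function spaces *)

Section banach_function_space.
Context d (T : measurableType d) (R : realType).
Variables (mu : {measure set T -> \bar R}) (D : set T) (X : function_space T R).
Hypothesis hX : is_banach_function_space mu D X.
Implicit Types f g : T -> R.

Lemma carrier0 f : carrier X f -> carrier X (fun=> 0).
Proof.
move=> /(bfs_scale hX 0); congr (carrier X _).
by apply/funext => x; rewrite mul0r.
Qed.

Lemma carrierB f g : carrier X f -> carrier X g -> carrier X (f \- g).
Proof.
move=> cf /(bfs_scale hX (-1)) /(bfs_add hX cf); congr (carrier X _).
by apply/funext => x /=; rewrite mulN1r.
Qed.

Lemma fnorm0 f : carrier X f -> fnorm X (fun=> 0) = 0.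
Proof.
move=> cf; have := bfs_normZ hX 0 cf; rewrite normr0 mul0r.
apply: etrans; congr (fnorm X _).
by apply/funext => x; rewrite mul0r.
Qed.

Lemma fnormBC f g : carrier X f -> carrier X g ->
  fnorm X (f \- g) = fnorm X (g \- f).
Proof.
move=> cf cg; rewrite -[RHS]mul1r -[X in X * _](normrN1 R).
rewrite -(bfs_normZ hX _ (carrierB cg cf)); congr (fnorm X _).
by apply/funext => x /=; rewrite mulN1r opprB.
Qed.

Lemma fnorm_ge0 f : carrier X f -> 0 <= fnorm X f.
Proof.
move=> cf; have cf' := bfs_scale hX (-1) cf.
have := bfs_normD hX cf cf'.
rewrite (bfs_normZ hX _ cf) normrN1 mul1r.
have -> : f \+ (fun x => -1 * f x) = fun=> 0.
  by apply/funext => x /=; rewrite mulN1r subrr.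
by rewrite (fnorm0 cf); lra.
Qed.

(* A norm limit of a nondecreasing sequence dominates it: the positive part of
   [u K - f] is dominated by [u k - f] for all [k >= K]. *)
Lemma carrier_limit_ge (u : nat -> T -> R) f :
  (forall k, carrier X (u k)) -> carrier X f ->
  (forall k x, D x -> u k x <= u k.+1 x) ->
  fnorm X (u k \- f) @[k --> \oo] --> 0 ->
  {ae mu, forall x, forall k, D x -> u k x <= f x}.
Proof.
move=> cu cf u_nd ulim; apply: ae_foralln => K.
pose w x := Num.max 0 (u K x - f x).
have mu_ k : measurable_fun D (u k) by exact: (bfs_measurable hX (cu k)).
have mw : measurable_fun D w.
  apply: measurable_maxr; first exact: measurable_cst.
  by apply: measurable_funB => //; exact: (bfs_measurable hX cf).
have nd k x : (K <= k)%N -> D x -> u K x <= u k x.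
  move=> /subnKC <- Dx; elim: (k - K)%N => [|m IH]; first by rewrite addn0.
  by rewrite addnS; exact: le_trans IH (u_nd _ _ Dx).
have wk k : (K <= k)%N -> carrier X w /\ fnorm X w <= fnorm X (u k \- f).
  move=> Kk; apply: (bfs_ideal hX mw (carrierB (cu k) cf)).
  apply: aeW => x Dx /=; rewrite ger0_norm ?le_max ?lexx//.
  rewrite ge_max normr_ge0/= (le_trans _ (ler_norm _))// lerD2r.
  exact: nd.
have [cw _] := wk K (leqnn K).
have w0 : fnorm X w = 0.
  apply/eqP; rewrite eq_le fnorm_ge0// andbT; apply/ler_addgt0Pr => e e0.
  have /cvgrPdist_lt /(_ _ e0)[k0 _ hk0] := ulim.
  have := hk0 (maxn K k0) (leq_maxr _ _); rewrite /= sub0r normrN => h.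
  have [_ /le_trans] := wk (maxn K k0) (leq_maxl _ _); apply.
  by rewrite add0r (le_trans (ler_norm _))// ltW.
have := bfs_norm0 hX cw w0; apply: filterS => x /[apply]; rewrite /w => h.
by move: h; rewrite -subr_le0 => <-; rewrite le_max lexx orbT.
Qed.

(** The partial sums are Cauchy by comparison with a geometric series. Their norm limit dominates
    them almost everywhere by [carrier_limit_ge], so no pointwise convergence has to be
    discussed. *)
Lemma carrier_series (u : nat -> T -> R) (r : R) (k0 : nat) : 0 < r -> r < 1 ->
  (forall k, carrier X (u k)) -> (forall k x, 0 <= u k x) ->
  (forall k, (k0 <= k)%N -> fnorm X (u k) <= r ^+ k) ->
  exists2 F, carrier X F &
    {ae mu, forall x, forall K, D x -> \sum_(k < K) u k x <= F x}.
Proof.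
move=> r0 r1 cu u0 ur; pose S K x := \sum_(k < K) u k x.
have SS K : S K.+1 = S K \+ u K.
  by apply/funext => x; rewrite /S big_ord_recr.
have cS K : carrier X (S K).
  elim: K => [|K IH]; last by rewrite SS; exact: (bfs_add hX).
  rewrite (_ : S 0%N = fun=> 0); first exact: carrier0 (cu 0%N).
  by apply/funext => x; rewrite /S big_ord0.
have r10 : 0 < 1 - r by rewrite subr_gt0.
(* The geometric tail bound, multiplied by [1 - r] so that it telescopes. *)
have tail i m : (k0 <= i)%N ->
    fnorm X (S (i + m)%N \- S i) * (1 - r) <= r ^+ i - r ^+ (i + m).
  move=> k0i; elim: m => [|m IH].
    rewrite addn0 subrr (_ : S i \- S i = fun=> 0).
      by rewrite (fnorm0 (cu 0%N)) mul0r.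
    by apply/funext => x; rewrite /= subrr.
  rewrite addnS SS.
  rewrite (_ : _ \- S i = (S (i + m)%N \- S i) \+ u (i + m)%N); last first.
    by apply/funext => x; rewrite /= addrAC.
  have h1 := bfs_normD hX (carrierB (cS (i + m)%N) (cS i)) (cu (i + m)%N).
  have h2 := ur (i + m)%N (leq_trans k0i (leq_addr _ _)).
  rewrite exprS; nra.
have [F cF SF] : exists2 F, carrier X F & fnorm X (S k \- F) @[k --> \oo] --> 0.
  apply: (bfs_complete hX cS) => e e0.
  have cr : r ^+ k @[k --> \oo] --> 0 by apply: cvg_expr; rewrite ger0_norm// ltW.
  have /cvgrPdist_lt /(_ (e * (1 - r)))[|k1 _ hk1] := cr; first by rewrite mulr_gt0.
  have main i j : (maxn k0 k1 <= i)%N -> (i <= j)%N -> fnorm X (S j \- S i) < e.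
    rewrite geq_max => /andP[k0i k1i] /subnKC <-.
    have := tail i (j - i)%N k0i; have := hk1 i k1i.
    rewrite /= sub0r normrN ger0_norm ?exprn_ge0 ?(ltW r0)// => h1 h2.
    have p : 0 <= r ^+ (i + (j - i)) by rewrite exprn_ge0// ltW.
    rewrite -(ltr_pM2r r10); lra.
  exists (maxn k0 k1) => i j Ki Kj; have [ij|/ltnW ji] := leqP i j.
    by rewrite fnormBC//; exact: main.
  exact: main.
exists F => //; apply: (carrier_limit_ge cS cF _ SF) => k x _.
by rewrite SS/= lerDl.
Qed.

End banach_function_space.

(** * The dominating series and the inclusion *)

Lemma dilation_series (R : realType) (Xbar : function_space (measurableTypeR R) R)
    (psi : R -> R) :
  is_banach_function_space (@lebesgue_measure R) (@unit_itv R) Xbar ->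
  0 < lower_boyd_index Xbar -> decreasing_profile psi -> carrier Xbar psi ->
  exists2 F, carrier Xbar F &
    {ae (@lebesgue_measure R), forall t, forall K, @unit_itv R t ->
      \sum_(k < K | 2 ^+ k * t <= 8^-1) psi (2 ^+ k.+1 * t) <= F t}.
Proof.
move=> hX alpha0 dpsi cpsi.
have [r [r0 r1 [k0 hk0]]] := dilation_norm_geometric alpha0.
(* The decay estimate concerns the unit ball, so [psi] is scaled into it; the added 1 avoids
   dividing by zero. *)
pose c := (`|fnorm Xbar psi| + 1)^-1.
have c0 : 0 < c by rewrite invr_gt0 ltr_wpDl.
pose phi t := c * psi t.
have cphi : carrier Xbar phi by exact: (bfs_scale hX).
have dphi : decreasing_profile phi.
  have [psi0 psi_ni] := dpsi; split=> [t|s t s0 st]; first by rewrite mulr_ge0// ltW.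
  by rewrite ler_pM2l//; exact: psi_ni.
have nphi : fnorm Xbar phi <= 1.
  rewrite (bfs_normZ hX _ cpsi) gtr0_norm// mulrC ler_pdivrMr ?ltr_wpDl// mul1r.
  by rewrite (le_trans (ler_norm _))// lerDl.
have s0 k : 0 < 2 ^- k :> R by rewrite invr_gt0 exprn_gt0.
have s1 k : 2 ^- k <= 1 :> R by rewrite invf_le1 ?exprn_gt0// exprn_ege1// ler1n.
pose u k := dilation (2 ^- k) phi.
have du k : decreasing_profile (u k) by exact: decreasing_profile_dilation.
(* A dilation by a factor at most 1 is dominated by the profile itself, so the ideal property
   applies. *)
have cu k : carrier Xbar (u k).
  have [] // := bfs_ideal hX (measurable_decreasing_profile (du k)) cphi.
  apply: aeW => t _; rewrite !ger0_norm; [exact: dilation_profile_le| |].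
  - by have [] := dphi.
  - by have [] := du k.
have u0 k t : 0 <= u k t by have [] := du k.
have ur k : (k0 <= k)%N -> fnorm Xbar (u k) <= r ^+ k by move=> ?; exact: hk0.
have [F cF hF] := carrier_series hX r0 r1 cu u0 ur.
exists (fun t => c^-1 * F t); first exact: (bfs_scale hX).
apply: filterS hF => t hF K It; have := hF K It.
rewrite -ler_pdivrMl ?invr_gt0// invrK; apply: le_trans.
rewrite mulr_sumr big_mkcond/=; apply: ler_sum => k _; case: ifP => // kt.
apply: dilation_profile_ge => //.
by move: It; rewrite /unit_itv/= in_itv/= => /andP[].
Qed.

Theorem theorem5 (R : realType) (n : nat) (hn : (0 < n)%N)
  (Q0 : set (Rn R n)) (hQ0 : is_cube Q0) (hQ0_1 : lebesgue_Rn R n Q0 = 1%:E)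
  (X : function_space (Rn R n) R)
  (hX : is_ri_space (lebesgue_Rn R n) Q0 X)
  (Xbar : function_space (measurableTypeR R) R)
  (hXbar : is_representation_space (lebesgue_Rn R n) Q0 X Xbar)
  (halpha : 0 < lower_boyd_index Xbar) :
  sharp_space Q0 X `<=` carrier X.
Proof.
move=> f [intf [h ch fh]].
have [[bX _ _] [[bXbar _ _] rep]] := (hX, hXbar).
have [a [l [l0 Q0E]]] := hQ0.
(* The lower corner of [Q0] has code 0 in every coordinate, so its closed cell of level 0 is
   [Q0]. *)
pose x0 : Rn R n := [tuple a i | i < n].
have Q0cell : closed_cell a l 0 x0 = Q0.
  have corner0 i : corner a l 0 x0 i = a i.
    by rewrite /corner ffunE tnth_mktuple /coordinate subrr mul0r mulr0 floor0 mulr0 addr0.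
  rewrite Q0E /closed_cell; apply/seteqP; split=> x hx i; have := hx i;
    by rewrite corner0 expr0 divr1.
have mQ0 : measurable Q0 by rewrite -Q0cell; exact: measurable_closed_cell.
have Q0oo : (lebesgue_Rn R n Q0 < +oo)%E by rewrite hQ0_1 ltry.
have mh : measurable_fun Q0 h by exact: (bfs_measurable bX).
have mf : measurable_fun Q0 f by have /integrableP[/measurable_EFinP] := intf.
pose fs := rearrangement (lebesgue_Rn R n) Q0 f.
pose hs := rearrangement (lebesgue_Rn R n) Q0 h.
have profile g : measurable_fun Q0 g ->
    decreasing_profile (rearrangement (lebesgue_Rn R n) Q0 g).
  move=> mg; split=> [t|s t]; first exact: rearrangement_ge0.
  exact: rearrangement_nonincreasing.
have chs : carrier Xbar hs by apply/(rep h mh).1.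
have [F cF hF] := dilation_series bXbar halpha (profile h mh) chs.
pose C : R := 2 + 8 * 2 ^+ n.
have C0 : 0 <= C by rewrite addr_ge0// mulr_ge0// exprn_ge0.
have step s : 0 < s -> s <= 8^-1 -> fs s <= fs (2 * s) + C * hs (2 * s).
  rewrite /fs /hs -Q0cell; apply: rearrangement_sharp_le => //;
    by rewrite Q0cell.
have [fs0 fs_ni] := profile f mf; have [hs0 _] := profile h mh.
have [c hc] := bfs_Linfty_sub bXbar.
have [cc _] : carrier Xbar (fun=> fs 8^-1) /\
    fnorm Xbar (fun=> fs 8^-1) <= c * `|fs 8^-1|.
  by apply: hc; [exact: measurable_cst|exact: aeW].
(* Membership is tested in the representation space, where [fs] is dominated by a constant plus a
   multiple of [F]. *)
apply/(rep f mf).1; pose W t := fs 8^-1 + C * F t.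
have cW : carrier Xbar W by apply: (bfs_add bXbar) => //; exact: (bfs_scale bXbar).
have [] // := bfs_ideal bXbar (measurable_decreasing_profile (profile f mf)) cW.
apply: filterS hF => t hF It; rewrite ger0_norm//.
apply: le_trans (ler_norm _); rewrite /W.
have t0 : 0 < t by move: It; rewrite /unit_itv/= in_itv/= => /andP[].
(* The number of doublings depends on [t], but [F] bounds all partial sums at once. *)
have [K Kt] : exists K : nat, 8^-1 < 2 ^+ K * t.
  exists (Num.truncn t^-1).+1.
  have : 1 < 2 ^+ (Num.truncn t^-1).+1 * t.
    rewrite -ltr_pdivrMr// div1r.
    apply: lt_le_trans (truncnS_gt _) _; rewrite -natrX ler_nat.
    exact: ltnW (ltn_expl _ _).
  by move=> ?; lra.
apply: (le_trans (doubling_iteration C0 hs0 fs_ni step t0 Kt)).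
by rewrite lerD2l ler_wpM2l//; exact: hF.
Qed.
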